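(* Let $S$ be a virtual shadow in which some precrossing has nonzero intersection index. For a positive integer $m$ let $C_m$ be the set of precrossings $c$ of $S$ with $|ind(c)|=m$. Then $$\mathrm{vir}(S)\le\min_m \left\{\frac{|C_m|}{2}+1\right\},$$ where $m$ ranges over all positive integers such that there exists a precrossing $\hat{c}$ of $S$ with $|ind(\hat{c})|=m$.
   Context: A virtual knot diagram is a generic closed curve in the plane each of whose double points is either a classical crossing (over/under information given) or a virtual crossing (circled, no over/under information). A virtual knot is an equivalence class of such diagrams under planar isotopy, the classical Reidemeister moves and the virtual Reidemeister moves; equivalently, planar isotopy, the classical Reidemeister moves and the detour move (a strand containing no classical crossings may be replaced by any other strand with the same endpoints and no classical crossings, all new double points being virtual). A virtual knot is classical if it has a diagram with no virtual crossings, and non-classical otherwise. A virtual shadow is such a diagram in which the virtual crossings are given, but every other double point is an undetermined crossing, called a precrossing. A precrossing is resolved by making it a positive or negative classical crossing (never a virtual crossing). The virtualizing number $\mathrm{vir}(S)$ is the minimum number of precrossings of $S$ that must be (suitably) resolved so that the result is necessarily non-classical, i.e. represents a non-classical virtual knot regardless of how the remaining precrossings are resolved; $\mathrm{vir}(S)=\infty$ if no resolution of the precrossings gives a non-classical knot. Orient $S$. Smoothing a precrossing $c$ in accordance with the orientation produces two oriented components $L_1,L_2$. The intersection index $ind(c)$ is the virtual shadow linking number of $L_1$ and $L_2$: the sum, over all precrossings (not virtual crossings) between $L_1$ and $L_2$, of a sign which is $+1$ if $L_2$ crosses $L_1$ in one fixed direction (say from left to right) and $-1$ if it crosses in the other direction.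 Interchanging $L_1$ and $L_2$, or reversing the sign convention, only changes the overall sign of $ind(c)$. *)

(* Defs.v *)
From HB Require Import structures.
From Stdlib Require Export Relation_Operators.
From mathcomp Require Export all_boot all_order all_algebra.
From mathcomp Require Export boolp constructive_ereal.

Set Implicit Arguments.
Unset Strict Implicit.
Unset Printing Implicit Defensive.

Import Order.TTheory GRing.Theory Num.Theory.
Local Open Scope ring_scope.

(** * Generic closed plane curves

    An oriented generic closed curve is recorded, up to isotopy, by the cyclic
    sequence of its passages through its double points (virtual ones included).
    The passage (x, b) goes through the double point x along the strand which
    the other strand at x crosses from right to left if b = true, and from left
    to right if b = false. Both passages through x occur, with opposite flags:
    if v, w are the directions of the strands (x, true), (x, false), then
    (v, w) is a positive basis. *)

Definition passage : Type := (nat * bool)%type.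

Definition twin (v : passage) : passage := (v.1, ~~ v.2).

Definition gauss_code (w : seq passage) : bool :=
  uniq w && all (fun v => twin v \in w) w.

Definition crossings (w : seq passage) : seq nat := [seq v.1 | v <- w & v.2].

(** The dart (v, d) is the edge of the curve ending (d = true) or starting
    (d = false) at the passage v, directed towards v; so d says whether the
    dart follows the orientation of the curve. *)
Definition darts (w : seq passage) : seq (passage * bool) :=
  [seq (v, d) | v <- w, d <- [:: true; false]].

(** The dart that follows p on the boundary of the region to the left of p:
    one turns left at the crossing p.1, which means leaving it along the other
    strand, following the orientation iff p.1.2 == p.2. *)
Definition left_turn (w : seq passage) (p : passage * bool) : passage * bool :=
  let d := p.1.2 == p.2 in
  ((if d then next w (twin p.1) else prev w (twin p.1)), d).

Definition nb_faces (w : seq passage) : nat :=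
  n_comp [rel p q : seq_sub (darts w) | left_turn w (val p) == val q] predT.

(** V - E + F = 2 for the 4-valent graph traced by the curve, which is connected
    and has size w edges. A curve without double points is a simple circle. *)
Definition planar (w : seq passage) : bool :=
  (w == [::]) || (size (crossings w) + nb_faces w == size w + 2)%N.

(** The curve lies in the plane compactified by a point at infinity; the region
    containing that point is not recorded. Moving a strand across infinity does
    not change the virtual knot, nor anything else defined below. *)
Record curve := Curve {
  code :> seq passage;
  codeP : gauss_code code && planar code }.

(** * Virtual knot diagrams *)

(** Classical s is a positive crossing if s = true, a negative one otherwise. *)
Inductive crossing_label := Virtual | Classical of bool.

(** Only the labels of the crossings of the curve are meaningful. *)
Record diagram := Diagram {
  diag_curve : curve;
  label : nat -> crossing_label }.

Definition rename (f : nat -> nat) (v : passage) : passage := (f v.1, v.2).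

(** Change of base point and of the names of the crossings, together with, if
    r = true, reversal of the orientation of the curve: reversing both strands
    at a crossing changes neither the flags of its passages nor its sign. *)
Definition same_diagram (D D' : diagram) : Prop :=
  exists (f : nat -> nat) (k : nat) (r : bool),
    [/\ {in crossings (diag_curve D) &, injective f},
        code (diag_curve D') =
          (let w := [seq rename f v | v <- rot k (diag_curve D)] in
           if r then rev w else w)
      & {in crossings (diag_curve D), forall x, label D' (f x) = label D x}].

(** At a positive crossing the under-strand crosses the over-strand from right
    to left, so the over-passage is the one whose flag is the sign. *)
Definition over (L : nat -> crossing_label) (v : passage) : Prop :=
  L v.1 = Classical v.2.

Definition virtual_at (L : nat -> crossing_label) (v : passage) : Prop :=
  L v.1 = Virtual.

(** A strand with passages p, q may be pulled over or virtually across. *)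
Definition over_or_virtual (L : nat -> crossing_label) (p q : passage) : Prop :=
  (over L p /\ over L q) \/ (virtual_at L p /\ virtual_at L q).

(** The passages p, q in the order in which a strand meets them, where d says
    whether the strand goes from p to q. *)
Definition strand (d : bool) (p q : passage) : seq passage :=
  if d then [:: p; q] else [:: q; p].

(** A triangle x y z with side a from x to y, side b from y to z and side c
    from z to x; da, db, dc say whether the strands a, b, c follow the boundary
    oriented as x -> y -> z -> x, and cw whether the triangle lies to the right
    (otherwise to the left) of the boundary so oriented. When one follows this
    boundary in the direction d of one strand and then e of the next one,
    turn cw d e is the flag at the corner of the first strand; this is what
    left_turn says for cw = false. *)
Definition turn (cw d e : bool) : bool := cw (+) (d == e).

(** Reidemeister moves, classical, virtual and mixed. The base point is chosen
    at the beginning of a strand taking part in the move. As both sides are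
    plane curves, the displayed pattern is a loop, bigon or triangle with
    nothing inside. *)
Inductive move : diagram -> diagram -> Prop :=
  | Move_same (D D' : diagram) :
      same_diagram D D' -> move D D'
  | Move_R1 (C C' : curve) (L : nat -> crossing_label) (x : nat) (b : bool) :
      code C' = [:: (x, b); (x, ~~ b)] ++ code C ->
      move (Diagram C L) (Diagram C' L)
    (* db says whether the two strands run in parallel; the first one may be
       taken to be the over-strand when x and y are classical *)
  | Move_R2 (C C' : curve) (L : nat -> crossing_label)
      (x y : nat) (b db : bool) (s t : seq passage) :
      code C = s ++ t ->
      code C' = [:: (x, b); (y, ~~ b)] ++ s
                ++ strand db (x, ~~ b) (y, b) ++ t ->
      over_or_virtual L (x, b) (y, ~~ b) ->
      move (Diagram C L) (Diagram C' L)
    (* a is the strand pulled across the crossing z of b and c: the uppermost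
       one if x, y and z are classical, and otherwise a virtual one *)
  | Move_R3 (C C' : curve) (L : nat -> crossing_label)
      (x y z : nat) (da db dc cw : bool) (s t u : seq passage) :
      let fx := turn cw dc da in
      let fy := turn cw da db in
      let fz := turn cw db dc in
      let triangle (ea eb ec : bool) :=
        strand ea (x, ~~ fx) (y, fy) ++ s
        ++ strand eb (y, ~~ fy) (z, fz) ++ t
        ++ strand ec (z, ~~ fz) (x, fx) ++ u in
      code C = triangle da db dc ->
      code C' = triangle (~~ da) (~~ db) (~~ dc) ->
      over_or_virtual L (x, ~~ fx) (y, fy) ->
      (L x <> Virtual -> L z <> Virtual) ->
      move (Diagram C L) (Diagram C' L).

Definition virtually_equivalent : diagram -> diagram -> Prop :=
  clos_refl_sym_trans diagram move.

Definition no_virtual_crossing (D : diagram) : Prop :=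
  {in crossings (diag_curve D), forall x, label D x <> Virtual}.

Definition classical_knot (D : diagram) : Prop :=
  exists D', virtually_equivalent D D' /\ no_virtual_crossing D'.

(** * Virtual shadows *)

(** The crossings of the curve that are not virtual are the precrossings. *)
Record virtual_shadow := VirtualShadow {
  shadow_curve : curve;
  is_virtual : pred nat }.

Definition precrossings (S : virtual_shadow) : seq nat :=
  [seq x <- crossings (shadow_curve S) | ~~ is_virtual S x].

Definition resolve (S : virtual_shadow) (rho : nat -> bool) : diagram :=
  Diagram (shadow_curve S)
    (fun x => if is_virtual S x then Virtual else Classical (rho x)).

(** Resolving the precrossings in A as prescribed by sigma is enough to get a
    non-classical knot. *)
Definition forces_nonclassical (S : virtual_shadow) (A : seq nat)
    (sigma : nat -> bool) : Prop :=
  forall rho : nat -> bool,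
    {in A, rho =1 sigma} -> ~ classical_knot (resolve S rho).

Definition nonclassical_with (S : virtual_shadow) (k : nat) : Prop :=
  exists (A : seq nat) (sigma : nat -> bool),
    [/\ uniq A, {subset A <= precrossings S}, size A = k
      & forces_nonclassical S A sigma].

(** The minimum is +oo when no k qualifies. *)
Definition vir (S : virtual_shadow) : \bar rat :=
  \big[mine/+oo%E]_(k < (size (precrossings S)).+1
                     | `[< nonclassical_with S k >]) ((k : nat)%:R)%:E.

(** Smoothing c along the orientation cuts the curve into the component that
    starts at (c, true) and the one that starts at (c, false); the passages
    through c itself are removed. *)
Definition smooth_component (w : seq passage) (c : nat) (b : bool)
    : seq passage :=
  behead (arc w (c, b) (c, ~~ b)).

(** With L1 starting at (c, true): a precrossing counts +1 if L2 crosses L1 from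
    left to right, that is, if the passage of L1 has flag false. *)
Definition ind (S : virtual_shadow) (c : nat) : int :=
  let L1 := smooth_component (shadow_curve S) c true in
  let L2 := smooth_component (shadow_curve S) c false in
  \sum_(v <- L1 | (v.1 \in precrossings S) && (twin v \in L2)) (-1) ^+ v.2.

Definition precrossings_of_index (S : virtual_shadow) (m : nat) : seq nat :=
  [seq c <- precrossings S | `|ind S c|%N == m].

(* Main.v *)
From HB Require Import structures.
Require Import Defs.
From mathcomp Require Import ring zify.

Set Implicit Arguments.
Unset Strict Implicit.
Unset Printing Implicit Defensive.

Import Order.TTheory GRing.Theory Num.Theory.
Local Open Scope ring_scope.

(** For n <> 0 the n-th writhe of an oriented virtual knot diagram is the sum of
    the signs of the classical crossings whose index, measured along the curve
    from the over- to the under-passage, equals n. It is invariant under the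
    Reidemeister moves; reversal of the orientation exchanges n and -n. It
    vanishes for classical knots: in a plane diagram without virtual crossings
    every index is 0, because the curve has an Alexander numbering.

    For a resolution of S, a precrossing c contributes 1 to the ind(c)-th writhe
    if it is positive and -1 to the (-ind(c))-th one if it is negative. Let p and
    q be the numbers of precrossings of index m and -m. The m-th and (-m)-th
    writhes differ by p - q for every resolution, so nothing need be resolved if
    p <> q. If p = q, making all the precrossings of index m and one of index -m
    positive forces the m-th writhe to be at least p - (q - 1) = 1. *)

(** * Alexander numberings of plane curves *)

(** A curve on a closed surface, with edge set E, face set F and one vertex for
    each pair {v, tw v}, where E also indexes the passages by the edge entering
    them; l and r give the face on either side of an edge. By Euler's formula,
    every cycle is a boundary; applied to the curve itself, this is the claim. *)
Lemma alexander_numbering_of_euler (E F : finType) (nxt tw : E -> E)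
    (flag : pred E) (l r : E -> F) (e0 : E) :
  injective nxt ->
  (forall P : E -> Prop, P e0 -> (forall v, P v -> P (nxt v)) -> forall v, P v) ->
  involutive tw -> (forall v, flag (tw v) = ~~ flag v) ->
  (forall phi, exists e, phi = l e \/ phi = r e) ->
  (forall v, flag v -> [/\ l v = l (nxt (tw v)), r (nxt v) = r (tw v),
                           l (tw v) = r v & r (nxt (tw v)) = l (nxt v)]) ->
  (#|[pred v | flag v]| + #|F| = #|E| + 2)%N ->
  exists A : E -> rat, forall v, flag v ->
    [/\ A (tw v) = A v - 1, A (nxt v) = A v - 1 & A (nxt (tw v)) = A v].
Proof.
move=> nxt_inj nxt_ind twK flag_tw faceP turnP euler.
pose V := {v | flag v}.
(* b1 and b2 are the boundary maps on edges and faces. *)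
pose b1 (z : {ffun E -> rat^o}) : {ffun V -> rat^o} :=
  [ffun c : V => z (val c) - z (nxt (val c))
                 + z (tw (val c)) - z (nxt (tw (val c)))].
pose b2 (u : {ffun F -> rat^o}) : {ffun E -> rat^o} := [ffun e => u (l e) - u (r e)].
have b1_lin : linear b1.
  by move=> a z z'; apply/ffunP => c; rewrite !ffunE /GRing.scale /=; ring.
have b2_lin : linear b2.
  by move=> a z z'; apply/ffunP => c; rewrite !ffunE /GRing.scale /=; ring.
pose f1 := linfun (HB.pack b1 (GRing.isLinear.Build _ _ _ _ b1 b1_lin) : {linear _ -> _}).
pose f2 := linfun (HB.pack b2 (GRing.isLinear.Build _ _ _ _ b2 b2_lin) : {linear _ -> _}).
have f1E z : f1 z = b1 z by rewrite lfunE.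
have f2E u : f2 u = b2 u by rewrite lfunE.
have dim_ffun (I : finType) : \dim {:{ffun I -> rat^o}} = #|I|.
  by rewrite dimvf /dim /= [dim _]/dim /= muln1.
have {}euler : (#|{: V}| + #|F| = #|E| + 2)%N by rewrite card_sig.
(* The curve is connected: the boundary of the edge [nxt e] is [vertex (nxt e) - vertex e], so the
   image of [f1] and a single vertex span everything. *)
have dim_img1 : (#|{: V}| <= (\dim (limg f1)).+1)%N.
  pose vertex e : {ffun V -> rat^o} :=
    [ffun c : V => (val c == e)%:R + (tw (val c) == e)%:R].
  have vertexP e : vertex e \in (limg f1 + <[vertex e0]>)%VS.
    elim/nxt_ind: e => [|e IHe]; first exact: subvP (addvSr _ _) _ (memv_line _).
    rewrite -(subrK (vertex e) (vertex (nxt e))) memvD //.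
    apply: subvP (addvSl _ _) _ _; apply/memv_imgP.
    exists [ffun e' => (e' == nxt e)%:R]; first exact: memvf.
    rewrite f1E; apply/ffunP => c; rewrite !ffunE !(inj_eq nxt_inj); ring.
  have imgV : (fullv <= limg f1 + <[vertex e0]>)%VS.
    apply/subvP => y _.
    have -> : y = \sum_c y c *: vertex (val c).
      apply/ffunP => c; rewrite sum_ffunE (bigD1 c) //= big1 => [|c' nc'].
        rewrite !ffunE eqxx.
        have /negbTE-> : tw (val c) != val c.
          by apply: contraL (valP c) => /eqP E1; rewrite -[X in flag X]E1 flag_tw (valP c).
        by rewrite /GRing.scale /= !addr0 mulr1.
      rewrite !ffunE val_eqE eq_sym (negbTE nc').
      have /negbTE-> : tw (val c) != val c'.
        by apply: contraL (valP c') => /eqP <-; rewrite flag_tw (valP c).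
      by rewrite /GRing.scale /= addr0 mulr0.
    by apply: memv_suml => c _; rewrite memvZ.
  have := leq_trans (dimvS imgV) (dimv_add_leqif _ _).
  by rewrite dim_ffun dim_vline => /leq_trans; apply; rewrite -addn1 leq_add2l leq_b1.
(* A face function with zero boundary agrees across every edge, hence is constant along the curve,
   which touches every face. *)
have dim_ker2 : (\dim (lker f2) <= 1)%N.
  suff /dimvS/leq_trans : (lker f2 <= <[([ffun=> 1] : {ffun F -> rat^o})]>)%VS.
    by apply; rewrite dim_vline leq_b1.
  apply/subvP => u; rewrite memv_ker f2E => /eqP/ffunP u_lr.
  have {}u_lr e : u (l e) = u (r e) by move/eqP: (u_lr e); rewrite !ffunE subr_eq0 => /eqP.
  have u_nxt e : u (l (nxt e)) = u (l e).
    have [/turnP|/negbTE fe] := boolP (flag e).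
      by case=> _ e2 e3 e4; rewrite u_lr e2 -u_lr e3 -u_lr.
    have := turnP (tw e); rewrite flag_tw fe twK => -[] // e1 e2 e3 e4.
    by rewrite -e1 e3 -u_lr.
  have u_const e : u (l e) = u (l e0) by elim/nxt_ind: e => // e; rewrite u_nxt.
  apply/vlineP; exists (u (l e0)); apply/ffunP => phi; rewrite !ffunE /GRing.scale /= mulr1.
  by have [e [->|->]] := faceP phi; rewrite -?u_lr.
have sub : (limg f2 <= lker f1)%VS.
  apply/subvP => _ /memv_imgP[u _ ->]; rewrite memv_ker f1E f2E; apply/eqP/ffunP => c.
  rewrite !ffunE; have [-> -> -> ->] := turnP _ (valP c); ring.
(* By rank-nullity the image of [f2] has dimension at least [#|F| - 1], and by [euler] the kernel of
   [f1] has at most that. *)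
have eqk : limg f2 = lker f1.
  apply/eqP; rewrite eqEdim sub /=.
  have := limg_ker_dim f1 fullv; have := limg_ker_dim f2 fullv.
  rewrite !capfv !dim_ffun; lia.
(* The curve itself, every edge taken once, is a cycle: two edges enter and two leave each vertex.
   Being the boundary of [u], it makes [u] drop by 1 from left to right of each edge. *)
have : [ffun=> 1] \in limg f2.
  rewrite eqk memv_ker f1E; apply/eqP/ffunP => c; rewrite !ffunE; ring.
move=> /memv_imgP[u _ /ffunP uP]; exists (u \o l) => v vf /=.
have [e1 e2 e3 e4] := turnP _ vf.
have := uP v; have := uP (nxt v); have := uP (tw v).
rewrite f2E !ffunE -e1 e2 e3 => h1 h2 h3.
have h4 : u (r v) = u (l v) - 1 by rewrite h3 opprB addrC subrK.
split=> //; rewrite -h4; apply: (addIr (- u (r (tw v)))); exact: etrans (esym h2) h1.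
Qed.

(** * Faces of a Gauss code *)

Lemma twinK : involutive twin.
Proof. by case=> x b; rewrite /twin negbK. Qed.

Lemma card_crossings (w : seq passage) :
  uniq w -> #|[pred v : seq_sub w | (val v).2]| = size (crossings w).
Proof.
move=> w_uniq; rewrite size_map cardE -(size_map val); apply/perm_size/uniq_perm.
- by rewrite map_inj_uniq ?enum_uniq //; exact: val_inj.
- exact: filter_uniq.
move=> v; rewrite mem_filter; apply/mapP/andP => [[u]|[v2 vw]].
  by rewrite mem_enum inE => u2 ->; split; last exact: valP.
by exists (SeqSub vw); rewrite ?mem_enum.
Qed.

Lemma mem_left_turn (w : seq passage) (p : passage * bool) :
  gauss_code w -> p \in darts w -> left_turn w p \in darts w.
Proof.
case/andP=> _ /allP w_twin /allpairsP[[v d] [/= vw _ ->]].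
apply/allpairsP; exists (left_turn w (v, d)); split=> //=; last by case: (_ == _).
by case: ifP => _; rewrite ?mem_next ?mem_prev w_twin.
Qed.

(** The new direction tells whether [next] or [prev] is to be undone; the flag then gives back the
    old direction. Hence the faces are the cycles of a permutation of the darts. *)
Lemma left_turn_inj (w : seq passage) : uniq w -> injective (left_turn w).
Proof.
move=> w_uniq [u d] [v e] [uv de].
have {}uv : u = v.
  apply: (can_inj twinK); move: uv; rewrite -de /=.
  by case: ifP => _; [apply: (can_inj (prev_next w_uniq)) | apply: (can_inj (next_prev w_uniq))].
by rewrite uv in de *; congr pair; move: de; case: v.2 d e {uv} => [] [] [].
Qed.

Lemma next_ind (w : seq passage) (P : passage -> Prop) (x : passage) :
  uniq w -> x \in w -> P x -> {in w, forall v, P v -> P (next w v)} ->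
  {in w, forall v, P v}.
Proof.
move=> w_uniq xw Px Pnext v vw; have /rot_to[i w' w'E] := xw.
have [w'_uniq w'w] : uniq (x :: w') /\ x :: w' =i w.
  by rewrite -w'E rot_uniq; split=> // u; rewrite mem_rot.
have {}Pnext u : u \in x :: w' -> P u -> P (next (x :: w') u).
  by rewrite -w'E (next_rot _ w_uniq) mem_rot => /Pnext.
move: vw; rewrite -w'w => vw; rewrite -(nth_index x vw).
move: vw; rewrite -index_mem; elim: (index v _) => // j IHj jw.
have := Pnext _ _ (IHj (ltnW jw)).
rewrite mem_nth ?(ltnW jw) // next_nth mem_nth ?(ltnW jw) // index_uniq ?(ltnW jw) //=.
by rewrite (set_nth_default x) //; exact.
Qed.

(** A v is the number of the region to the left of the edge entering v. *)
Lemma planar_alexander (w : seq passage) :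
  gauss_code w -> planar w ->
  exists A : passage -> rat, forall c, (c, true) \in w ->
    [/\ A (c, false) = A (c, true) - 1, A (next w (c, true)) = A (c, true) - 1
      & A (next w (c, false)) = A (c, true)].
Proof.
move=> gw; have /andP[w_uniq /allP w_twin] := gw.
case/predU1P=> [->|/eqP euler]; first by exists (fun _ => 0).
have [->|[e0v e0w]] : w = [::] \/ exists v, v \in w.
- by case: w {gw w_uniq w_twin euler} => [|v w]; [left | right; exists v; rewrite mem_head].
- by exists (fun _ => 0).
pose E := seq_sub w; pose P := seq_sub (darts w).
pose nxt (v : E) : E := SeqSub (etrans (mem_next w (val v)) (valP v)).
pose prv (v : E) : E := SeqSub (etrans (mem_prev w (val v)) (valP v)).
pose tw (v : E) : E := SeqSub (w_twin _ (valP v)).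
have mem_dart (v : E) d : (val v, d) \in darts w.
  by apply/allpairsP; exists (val v, d); split; [exact: valP | case: d |].
pose dart v d : P := SeqSub (mem_dart v d).
pose turn (p : P) : P := SeqSub (mem_left_turn gw (valP p)).
have turn_inj : injective turn.
  by move=> p q /(congr1 val)/(left_turn_inj w_uniq)/val_inj.
have turn_sym := fconnect_sym turn_inj.
pose F : finType := {p : P | froots turn p}.
have card_F : #|F| = nb_faces w.
  rewrite [LHS]card_sig /nb_faces -(@eq_n_comp _ (frel turn)); last exact: eq_connect.
  by apply: eq_card => p; rewrite !inE andbT.
pose face p : F := exist _ (froot turn p) (roots_root turn_sym p).
have faceE p q : turn p = q -> face p = face q.
  move=> <-; apply: val_inj; apply/(fingraph.rootP turn_sym); exact: fconnect1.
(* The right side of the edge entering [v] is the left side of the same edge reversed, which is the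
   dart [(prv v, false)]. *)
have [] := @alexander_numbering_of_euler E F nxt tw (fun v => (val v).2)
   (fun v => face (dart v true)) (fun v => face (dart (prv v) false)) (SeqSub e0w).
- by move=> u v [] /(can_inj (prev_next w_uniq))/val_inj.
- move=> Q Q0 Qnext v.
  suff: exists vw : val v \in w, Q (SeqSub vw).
    by case=> vw; congr Q; exact: val_inj.
  apply: (@next_ind w (fun v => exists vw : v \in w, Q (SeqSub vw)) e0v) (valP v) => //.
    by exists e0w.
  move=> u _ [uw Qu]; have := Qnext _ Qu => Qnu.
  have uw' := valP (nxt (SeqSub uw)); exists uw'; move: Qnu; congr Q; exact: val_inj.
- by move=> v; apply: val_inj; rewrite /= twinK.
- by [].
- move=> [p p_root]; have /allpairsP[[v d] [/= vw _ pE]] := valP p.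
  have pp : face p = exist _ p p_root by apply: val_inj; exact/eqP.
  case: d pE => pE; [exists (SeqSub vw); left | exists (nxt (SeqSub vw)); right].
    by rewrite -pp; congr face; apply: val_inj.
  by rewrite -pp; congr face; apply: val_inj; rewrite /= prev_next.
(* Each of the four face identities is a single left turn at the crossing. *)
- move=> [[x b] vw] /= v2; move: vw; rewrite {b}v2 => vw.
  split; apply: faceE; apply: val_inj; rewrite /= ?prev_next /left_turn //=.
- by rewrite card_seq_sub // card_crossings // -euler; congr (_ + _)%N; exact: card_F.
move=> A AP; exists (fun v => if insub v is Some e then A e else 0) => c cw.
have [] := AP (SeqSub cw) isT.
have insE (v : E) u : val v = u -> insub u = Some v by move=> <-; rewrite valK.
rewrite (insE (SeqSub cw) (c, true)) // (insE (tw (SeqSub cw)) (c, false)) //.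
by rewrite (insE (nxt (SeqSub cw)) (next w (c, true))) //
           (insE (nxt (tw (SeqSub cw))) (next w (c, false))).
Qed.

(** * The index of a passage *)

(** If v is not in w, this is the total weight of w. *)
Fixpoint height (g : passage -> int) (w : seq passage) (v : passage) : int :=
  if w is u :: w' then if u == v then 0 else g u + height g w' v else 0.

(** For v = (c, true) this is ind S c (see ind_gap). Since the total weight of a
    Gauss code is 0, heights may be used although the code is cyclic. *)
Definition gap (g : passage -> int) (w : seq passage) (v : passage) : int :=
  height g w (twin v) - height g w v - g v.

Definition odd_weight (g : passage -> int) : Prop := forall v, g (twin v) = - g v.

Lemma gap_twin g w v : odd_weight g -> gap g w (twin v) = - gap g w v.
Proof. by rewrite /gap twinK => ->; ring. Qed.

Lemma height_notin g w v : v \notin w -> height g w v = \sum_(u <- w) g u.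
Proof.
elim: w => [|u w IHw]; first by rewrite big_nil.
by rewrite inE negb_or big_cons eq_sym /= => /andP[/negbTE-> /IHw ->].
Qed.

Lemma height_cat g w1 w2 v :
  height g (w1 ++ w2) v = height g w1 v + (if v \in w1 then 0 else height g w2 v).
Proof.
elim: w1 => [|u w1 IHw]; first by rewrite add0r.
by rewrite inE /= eq_sym; case: eqP => //= _; rewrite IHw addrA.
Qed.

Lemma height_map g g' (h : passage -> passage) w v :
  {in v :: w &, injective h} -> {in w, forall u, g' (h u) = g u} ->
  height g' (map h w) (h v) = height g w v.
Proof.
elim: w => //= u w IHw h_inj g'h.
rewrite (inj_in_eq h_inj) ?inE ?eqxx ?orbT // g'h ?mem_head // IHw //.
  by move=> a b; rewrite !inE => aw bw; apply: h_inj; rewrite !inE orbCA ?aw ?bw orbT.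
by move=> a aw; apply: g'h; rewrite inE aw orbT.
Qed.

(** The passages before [v] in [rev w] are those after [v] in [w]. *)
Lemma height_rev g w v :
  uniq w -> v \in w -> height g (rev w) v = \sum_(u <- w) g u - height g w v - g v.
Proof.
elim: w => //= u w IHw /andP[u_w w_uniq].
rewrite inE rev_cons -cats1 height_cat mem_rev big_cons eq_sym /=.
case: eqP => [<-|_] /=.
  by rewrite (negbTE u_w) height_notin ?mem_rev // big_rev => _; ring.
by move=> vw; rewrite vw IHw //; ring.
Qed.

(** Replacing each passage by its twin permutes [w] and negates the sum. *)
Lemma sum_odd_weight g (w : seq passage) :
  odd_weight g -> uniq w -> {in w, forall v, twin v \in w} -> \sum_(v <- w) g v = 0.
Proof.
move=> g_odd w_uniq w_twin.
have twin_perm : perm_eq (map twin w) w.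
  apply: uniq_perm => //; first by rewrite (map_inj_uniq (can_inj twinK)).
  move=> v; apply/mapP/idP => [[u uw ->]|vw]; first exact: w_twin.
  by exists (twin v); rewrite ?twinK ?w_twin.
have: \sum_(v <- w) g v = - \sum_(v <- w) g v.
  rewrite -{1}(perm_big _ twin_perm) big_map -sumrN; exact: eq_bigr.
by lia.
Qed.

(** A new base point shifts all heights by one constant, so their differences depend only on the
    cyclic word. *)
Lemma height_rot g w k v :
  uniq w -> \sum_(u <- w) g u = 0 -> v \in w ->
  height g (rot k w) v = height g w v + \sum_(u <- drop k w) g u.
Proof.
rewrite -{1 2 3 5}(cat_take_drop k w) /rot !height_cat mem_cat cat_uniq big_cat /=.
move=> /and3P[_ /hasPn disj _] sum0.
have [vA _|vA /= vB] := boolP (v \in take k w); last first.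
  by rewrite vB (height_notin _ vA) addrAC sum0 add0r addr0.
have vB : v \notin drop k w by apply: contraL vA => /disj.
by rewrite (negbTE vB) (height_notin _ vB); ring.
Qed.

(** At the last passage [next] wraps around to height 0, which is consistent because the total
    weight vanishes. With the base point at [v], the wrap occurs only in a word of length 1. *)
Lemma height_next g w v :
  uniq w -> \sum_(u <- w) g u = 0 -> v \in w ->
  height g w (next w v) = height g w v + g v.
Proof.
move=> w_uniq sum0 vw; have [k w' rotE] := rot_to vw.
apply: (addIr (\sum_(u <- drop k w) g u)).
rewrite addrAC -!height_rot ?mem_next // -(next_rot k w_uniq).
have: \sum_(u <- rot k w) g u = 0 by rewrite (perm_big _ (permEl (perm_rot k w))).
have: uniq (rot k w) by rewrite rot_uniq.
rewrite rotE /= eqxx; case: w' {rotE} => [|u w'] /=.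
  by rewrite !eqxx big_seq1 add0r => _ ->.
by rewrite inE negb_or !eqxx => /andP[/andP[/negbTE-> _] _] _; ring.
Qed.

(** * Writhes *)

Lemma gauss_uniq w : gauss_code w -> uniq w. Proof. by case/andP. Qed.

Lemma gauss_twin w : gauss_code w -> {in w, forall v, twin v \in w}.
Proof. by case/andP=> _ /allP. Qed.

Lemma perm_gauss_code w w' : perm_eq w w' -> gauss_code w = gauss_code w'.
Proof.
move=> ww'; rewrite /gauss_code (perm_uniq ww') (perm_all _ ww').
by congr (_ && _); apply: eq_all => v; rewrite (perm_mem ww').
Qed.

Lemma crossings_mem w v : gauss_code w -> (v.1 \in crossings w) = (v \in w).
Proof.
case: v => x b gw; apply/mapP/idP => [[[y c]] | xw].
  rewrite mem_filter => /andP[/= c1 yw] ->; move: yw; rewrite c1.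
  by case: b => // /(gauss_twin gw).
exists (x, true); rewrite // mem_filter.
by case: b xw => // /(gauss_twin gw).
Qed.

Lemma gap_map g g' (f : nat -> nat) w v :
  gauss_code w -> {in w &, injective (rename f)} ->
  {in w, forall u, g' (rename f u) = g u} -> v \in w ->
  gap g' (map (rename f) w) (rename f v) = gap g w v.
Proof.
move=> gw f_inj g'f vw; rewrite /gap g'f //.
have in_w u : u \in w -> {in u :: w &, injective (rename f)}.
  move=> uw a b; rewrite !inE => aw bw; apply: f_inj.
    by case/predU1P: aw => [->|].
  by case/predU1P: bw => [->|].
have -> : twin (rename f v) = rename f (twin v) by [].
by rewrite !(@height_map g g') //; apply: in_w => //; exact: gauss_twin.
Qed.

Lemma gap_rot g w k v :
  odd_weight g -> gauss_code w -> v \in w -> gap g (rot k w) v = gap g w v.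
Proof.
move=> g_odd gw vw; have sum0 := sum_odd_weight g_odd (gauss_uniq gw) (gauss_twin gw).
by rewrite /gap !height_rot ?(gauss_uniq gw) ?(gauss_twin gw) //; ring.
Qed.

Lemma gap_rev g w v :
  odd_weight g -> gauss_code w -> v \in w -> gap g (rev w) v = - gap g w v.
Proof.
move=> g_odd gw vw.
by rewrite /gap !height_rev ?(gauss_uniq gw) ?(gauss_twin gw) // g_odd; ring.
Qed.

(** Heights and the Alexander numbering change by the same amounts along the curve, so they differ
    by a constant. The drop of the numbering from [(c, true)] to [(c, false)] then cancels the term
    [g (c, true) = -1]. *)
Lemma planar_gap g w :
  odd_weight g -> gauss_code w -> planar w ->
  {in w, forall v, g v = (-1) ^+ v.2} -> {in w, forall v, gap g w v = 0}.
Proof.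
move=> g_odd gw pw g1.
have [A AP] := planar_alexander gw pw.
have w_uniq := gauss_uniq gw; have w_twin := gauss_twin gw.
have sum0 := sum_odd_weight g_odd w_uniq w_twin.
have A_next v : v \in w -> A (next w v) = A v + (g v)%:~R.
  move=> vw; rewrite g1 //; case: v vw => c [] cw.
    by have [_ -> _] := AP _ cw; rewrite expr1 rmorphN1.
  have [-> _ ->] := AP _ (w_twin _ cw); by rewrite expr0 subrK.
have heightE u : u \in w ->
    {in w, forall v, (height g w v)%:~R - A v = (height g w u)%:~R - A u}.
  move=> uw; apply: (next_ind w_uniq uw) => // v vw <-.
  by rewrite height_next // A_next // rmorphD /=; ring.
have gap_true c : (c, true) \in w -> gap g w (c, true) = 0.
  move=> cw; apply: (@intr_inj rat); rewrite /gap g1 //.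
  have := heightE _ cw _ (w_twin _ cw); have [-> _ _] := AP _ cw => E.
  rewrite !rmorphB expr1 /= rmorphN1 opprK.
  by rewrite -(subrK (A (c, true) - 1) (height g w _)%:~R) {}E; ring.
case=> c [] vw; first exact: gap_true.
by apply: oppr_inj; rewrite oppr0 -gap_twin //; apply: gap_true; exact: (w_twin _ vw).
Qed.

(** Over/under information is ignored, so all resolutions of a shadow share the same indices; the
    sign is the one used in [ind]. *)
Definition weight (L : nat -> crossing_label) (v : passage) : int :=
  if L v.1 is Classical _ then (-1) ^+ v.2 else 0.

Definition is_over (L : nat -> crossing_label) (v : passage) : bool :=
  if L v.1 is Classical e then e == v.2 else false.

(** The crossings are enumerated by their over-passages. *)
Definition writhe (L : nat -> crossing_label) (w : seq passage) (n : int) : int :=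
  \sum_(v <- w | is_over L v && (gap (weight L) w v == n)) (-1) ^+ (~~ v.2).

Lemma weight_odd L : odd_weight (weight L).
Proof.
by case=> x []; rewrite /weight /=; case: (L x) => // _; rewrite ?expr1 ?opprK.
Qed.

Lemma writhe_planar_classical D n :
  no_virtual_crossing D -> n != 0 -> writhe (label D) (diag_curve D) n = 0.
Proof.
have /andP[gw pw] := codeP (diag_curve D) => nv n0; rewrite /writhe big_seq_cond big_pred0 // => v.
apply/and3P => -[vw _ /eqP gap_n]; move: n0; rewrite -gap_n.
rewrite planar_gap ?eqxx //; first exact: weight_odd.
move=> [x b] xw; rewrite /weight /=.
have /nv : x \in crossings (diag_curve D) by rewrite (crossings_mem (x, b)).
by case: (label D x).
Qed.

(** Renaming and a change of base point preserve gaps, reversal negates them; [r] records the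
    reversal. *)
Lemma writhe_same_diagram D D' :
  same_diagram D D' ->
  exists r : bool, forall n,
    writhe (label D') (diag_curve D') n = writhe (label D) (diag_curve D) ((-1) ^+ r * n).
Proof.
have /andP[gw _] := codeP (diag_curve D); have /andP[gw' _] := codeP (diag_curve D').
case=> f [k [r []]].
move: gw gw' (label D) (label D') => /=.
move: (code (diag_curve D)) (code (diag_curve D')) => w w' gw gw' L L' f_inj w'E L'E.
have L'f v : v \in w -> L' (f v.1) = L v.1 by rewrite -crossings_mem // => /L'E.
have rf_inj : {in w &, injective (rename f)}.
  move=> [x b] [y c] xw yw [fxy ->]; congr pair; apply: f_inj fxy.
    by rewrite (crossings_mem (x, b)).
  by rewrite (crossings_mem (y, c)).
have wf v : v \in w -> weight L' (rename f v) = weight L v.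
  by move=> vw; rewrite /weight /= L'f.
exists r => n; rewrite /writhe.
have perm_w' : perm_eq w' (map (rename f) w).
  rewrite w'E map_rot; case: (r); last by rewrite perm_rot.
  by rewrite perm_rev perm_rot.
rewrite (perm_big _ perm_w') big_map big_seq_cond [RHS]big_seq_cond.
apply: eq_big => // v; apply: andb_id2l => vw; congr (_ && _).
  by rewrite /is_over /= L'f.
have fw_gauss : gauss_code (map (rename f) w).
  by rewrite -(perm_gauss_code perm_w').
have fvw : rename f v \in map (rename f) w by exact: map_f.
rewrite w'E map_rot -(gap_map gw rf_inj wf vw); case: (r) => /=.
  rewrite expr1 mulN1r gap_rev ?mem_rot ?gap_rot ?eqr_oppLR //; try exact: weight_odd.
  by rewrite (perm_gauss_code (w' := map (rename f) w)) // perm_rot.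
by rewrite expr0 mul1r gap_rot //; exact: weight_odd.
Qed.

(** * Invariance under the moves *)

Lemma is_over_weight L v : is_over L v -> weight L v = (-1) ^+ v.2.
Proof. by rewrite /is_over /weight; case: (L v.1). Qed.

Lemma eq_writhe L w w' n :
  perm_eq w w' ->
  {in w, forall v, is_over L v -> gap (weight L) w' v = gap (weight L) w v} ->
  writhe L w' n = writhe L w n.
Proof.
move=> ww' gapE; rewrite /writhe -(perm_big _ ww') big_seq_cond [RHS]big_seq_cond.
apply: eq_bigl => v; apply: andb_id2l => vw; apply: andb_id2l => v_over.
by rewrite gapE.
Qed.

Lemma mem_strand d p q v : (v \in strand d p q) = (v == p) || (v == q).
Proof. by case: d; rewrite !inE // orbC. Qed.

Lemma perm_strand d e p q : perm_eq (strand d p q) (strand e p q).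
Proof.
by case: d; case: e; rewrite /strand //=; apply/permP => P /=; rewrite addnCA.
Qed.

Lemma height_strand g d p q v :
  v != p -> v != q -> height g (strand d p q) v = g p + g q.
Proof.
move=> vp vq; rewrite height_notin; last by rewrite mem_strand negb_or vp.
by case: d; rewrite big_cons big_seq1 // addrC.
Qed.

(** The passages through [x] are adjacent, so [x] has index 0, and their opposite weights leave all
    other heights unchanged. *)
Lemma writhe_R1 L w x b n :
  gauss_code w -> gauss_code ([:: (x, b); (x, ~~ b)] ++ w) -> n != 0 ->
  writhe L ([:: (x, b); (x, ~~ b)] ++ w) n = writhe L w n.
Proof.
move=> gw gw' n0; have g_odd := weight_odd L; set g := weight L.
have gap_x : gap g ([:: (x, b); (x, ~~ b)] ++ w) (x, b) = 0.
  rewrite /gap /twin /= !eqxx; case: eqP => [[]|_]; first by case: (b).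
  by rewrite addr0 subr0 subrr.
have gap_x' : gap g ([:: (x, b); (x, ~~ b)] ++ w) (x, ~~ b) = 0.
  by rewrite (gap_twin _ (x, b)) // gap_x oppr0.
rewrite /writhe !big_cons -/g gap_x gap_x' eq_sym (negbTE n0) !andbF.
rewrite big_seq_cond [RHS]big_seq_cond; apply: eq_bigl => v; apply: andb_id2l => vw.
congr (_ && (_ == _)).
have skip u : u \in w -> height g ([:: (x, b); (x, ~~ b)] ++ w) u = height g w u.
  move=> uw; have := gauss_uniq gw'; rewrite /= inE negb_or.
  case/andP=> /andP[_ xw] /andP[xw' _]; case: eqP xw => [->|_ _]; first by rewrite uw.
  case: eqP xw' => [->|_ _]; first by rewrite uw.
  by have := g_odd (x, b); rewrite /twin /= -/g => ->; rewrite addrA subrr add0r.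
by rewrite /gap !skip //; exact: (gauss_twin gw).
Qed.

(** On each strand the two new weights cancel, so the old gaps survive. The new crossings have equal
    index and, if classical, opposite signs. *)
Lemma writhe_R2 L x y b db s t n :
  let w := s ++ t in
  let w' := [:: (x, b); (y, ~~ b)] ++ s ++ strand db (x, ~~ b) (y, b) ++ t in
  gauss_code w -> gauss_code w' -> over_or_virtual L (x, b) (y, ~~ b) ->
  writhe L w' n = writhe L w n.
Proof.
move=> w w' gw gw' ov; have g_odd := weight_odd L; set g := weight L.
pose new := [:: (x, b); (y, ~~ b)] ++ strand db (x, ~~ b) (y, b).
have w'E : perm_eq w' (new ++ w).
  by rewrite /w' /new /w -catA perm_cat2l perm_catCA.
have := gauss_uniq gw'; rewrite (perm_uniq w'E) cat_uniq => /and3P[new_uniq /hasPn w_new _].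
have gy : g (y, ~~ b) = - g (x, b).
  have := g_odd (x, b); rewrite /g /weight /=.
  by case: ov => -[]; rewrite /over /virtual_at /= => -> ->.
have gy' : g (y, b) = - g (x, ~~ b).
  by have := g_odd (x, b); have := g_odd (y, b); rewrite /twin /= -/g; lia.
have xy : (x == y) = false.
  apply/negP => /eqP xy; move: new_uniq; rewrite /new xy.
  by case: (db); rewrite /= !inE !xpair_eqE !eqxx /= ?orbT ?andbF.
have skip v : v \in w -> height g w' v = height g w v.
  move=> vw; have := w_new _ vw; rewrite /new !(inE, mem_cat, mem_strand) !negb_or.
  case/and4P=> /negbTE vx /negbTE vy vx' vy'.
  rewrite /w' /= eq_sym vx eq_sym vy !height_cat mem_strand height_strand //.
  by rewrite (negbTE vx') (negbTE vy') gy gy' !subrr add0r addNKr.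
have gapE v : v \in w -> gap g w' v = gap g w v.
  by move=> vw; rewrite /gap !skip //; exact: (gauss_twin gw).
rewrite /writhe (perm_big _ w'E) big_cat /= [X in _ + X](_ : _ = writhe L w n); last first.
  rewrite /writhe big_seq_cond [RHS]big_seq_cond.
  by apply: eq_bigl => v; apply: andb_id2l => vw; rewrite gapE.
rewrite /writhe -/g -[RHS]add0r; congr (_ + _); rewrite big_cat /= !big_cons big_nil -/g.
(* Both gaps are the weight of [s], less [g (x, b)] when the strands run in parallel. *)
have gap_xy : gap g w' (x, b) = gap g w' (y, ~~ b).
  have ns v : v \in new -> v \in s = false.
    by move=> vnew; apply: contraTF vnew => vs; apply: w_new; rewrite mem_cat vs.
  have xs c : ((x, c) \in s = false) * ((y, c) \in s = false).
    by split; apply: ns; rewrite /new !(inE, mem_cat, mem_strand) !xpair_eqE !eqxx;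
      case: (c); case: (b); rewrite ?orbT.
  have hs c : (height g s (x, c) = \sum_(u <- s) g u) * (height g s (y, c) = \sum_(u <- s) g u).
    by split; rewrite height_notin ?xs.
  have gx : g (x, false) = - g (x, true) := g_odd (x, true).
  rewrite /gap /w' /twin !height_cat /= !negbK !xs; move: gy gy'.
  case: (b) => /= gy gy'; case: (db) => /=;
    rewrite !inE ?xpair_eqE ?(eq_sym y x) ?xy ?eqxx /= ?xs ?hs ?xy ?gy ?gy' ?gx; ring.
rewrite gap_xy -(perm_big _ (perm_strand true db _ _)) !big_cons big_nil.
case: ov => -[]; rewrite /over /virtual_at /is_over /= => -> ->; last by [].
by case: (b); case: (_ == n).
Qed.

(** The pattern of [Move_R3], with the corner flags as parameters: the two sides of the move differ
    only in [da], [db], [dc]. *)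
Definition triangle x y z (fx fy fz da db dc : bool) (s t u : seq passage) :=
  strand da (x, ~~ fx) (y, fy) ++ s ++ strand db (y, ~~ fy) (z, fz) ++ t
  ++ strand dc (z, ~~ fz) (x, fx) ++ u.

(** The move swaps the two passages on each side of the triangle. A distant crossing sees no change,
    as each side keeps its total weight. At a corner, passages of the other two corners move past
    its own, and the effects cancel if those two have equal weights. For [z] these are [x] and [y];
    for [x] or [y] the weight of [z] matters too. *)
Lemma gap_R3 g x y z da db dc cw s t u v :
  let T := triangle x y z (turn cw dc da) (turn cw da db) (turn cw db dc) in
  let w := T da db dc s t u in
  let w' := T (~~ da) (~~ db) (~~ dc) s t u in
  odd_weight g -> gauss_code w -> v \in w ->
  g (x, true) = g (y, true) ->
  g (x, true) = g (z, true) \/ v.1 = z \/ v.1 \notin [:: x; y; z] ->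
  gap g w' v = gap g w v.
Proof.
move=> T w w' g_odd gw vw gxy gz.
pose fx := turn cw dc da; pose fy := turn cw da db; pose fz := turn cw db dc.
pose six := [:: (x, ~~ fx); (y, fy); (y, ~~ fy); (z, fz); (z, ~~ fz); (x, fx)].
have wE : perm_eq w (six ++ s ++ t ++ u).
  have count_strand P d p q : count P (strand d p q) = (P p + P q)%N.
    by case: d; rewrite /= addn0 // addnC.
  by apply/permP => P; rewrite /w /T /triangle !count_cat !count_strand /=; ring.
have := gauss_uniq gw; rewrite (perm_uniq wE) cat_uniq => /and3P[six_uniq /hasPn stu_six _].
have six_neq : [/\ (x == y) = false, (y == z) = false & (x == z) = false].
  by split; apply/negP => /eqP E; move: six_uniq; rewrite /six E /= !inE !xpair_eqE !eqxx;
    case: (fx); case: (fy); case: (fz); rewrite /= ?andbF ?orbT.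
have [xy yz xz] := six_neq.
pose avoids (r : seq passage) := forall c,
  ((x, c) \in r = false) * ((y, c) \in r = false) * ((z, c) \in r = false).
have out (r : seq passage) : {subset r <= s ++ t ++ u} -> avoids r.
  move=> sub_r c.
  by split; [split|]; apply/negP => /sub_r/stu_six; rewrite /six !inE !xpair_eqE !eqxx;
    case: c; case: (fx); case: (fy); case: (fz); rewrite ?orbT.
have xs : {subset s <= s ++ t ++ u} by move=> a; rewrite mem_cat => ->.
have xt : {subset t <= s ++ t ++ u} by move=> a; rewrite !mem_cat => ->; rewrite orbT.
have xu : {subset u <= s ++ t ++ u} by move=> a; rewrite !mem_cat => ->; rewrite !orbT.
have {xs xt xu} [[xs xt] xu] := (out _ xs, out _ xt, out _ xu).
have hs r (xr : avoids r) c :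
   (height g r (x, c) = \sum_(a <- r) g a) * (height g r (y, c) = \sum_(a <- r) g a)
   * (height g r (z, c) = \sum_(a <- r) g a).
  by split; [split|]; rewrite height_notin ?xr.
have far a : a.1 \notin [:: x; y; z] -> height g w' a = height g w a.
  rewrite !inE !negb_or => /and3P[ax ay az].
  have neq c b : a.1 != c -> a != (c, b) by apply: contra => /eqP ->.
  by rewrite /w' /w /T /triangle !height_cat !mem_strand !height_strand ?neq.
have [v_near|v_far] := boolP (v.1 \in [:: x; y; z]); last first.
  by rewrite /gap !far.
suff near c : c \in [:: x; y; z] -> g (x, true) = g (z, true) \/ c = z ->
    gap g w' (c, true) = gap g w (c, true).
  have {}near : gap g w' (v.1, true) = gap g w (v.1, true).
    by apply: near => //; case: gz => [|[]]; [left | right | rewrite v_near].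
  by case: v {vw v_near gz} near => c [] //= near; rewrite !(gap_twin _ (c, true)) ?near.
have gF a : g (a, false) = - g (a, true) := g_odd (a, true).
have [yx zy zx] : [/\ (y == x) = false, (z == y) = false & (z == x) = false].
  by rewrite (eq_sym y) (eq_sym z) (eq_sym z).
rewrite /gap /w' /w /T /triangle !height_cat !mem_strand /twin /= !inE.
clear T w w' gw vw fx fy fz six wE six_uniq stu_six far out six_neq.
case/or3P=> /eqP-> => [[gxz|xz_eq]|[gxz|yz_eq]|_].
(* For each choice of directions and of [cw], a linear identity in the weights of the corners and of
   [s], [t], [u] remains. *)
- case: da; case: db; case: dc; case: cw;
    rewrite /= !xpair_eqE ?eqxx ?xy ?yx ?yz ?zy ?xz ?zx /=
      ?xs ?xt ?xu ?(hs _ xs) ?(hs _ xt) ?(hs _ xu) ?gF -?gxy -?gxz; ring.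
- by rewrite xz_eq eqxx in xz.
- case: da; case: db; case: dc; case: cw;
    rewrite /= !xpair_eqE ?eqxx ?xy ?yx ?yz ?zy ?xz ?zx /=
      ?xs ?xt ?xu ?(hs _ xs) ?(hs _ xt) ?(hs _ xu) ?gF -?gxy -?gxz; ring.
- by rewrite yz_eq eqxx in yz.
- case: da; case: db; case: dc; case: cw;
    rewrite /= !xpair_eqE ?eqxx ?xy ?yx ?yz ?zy ?xz ?zx /=
      ?xs ?xt ?xu ?(hs _ xs) ?(hs _ xt) ?(hs _ xu) ?gF -?gxy; ring.
Qed.

Lemma perm_triangle x y z fx fy fz da db dc ea eb ec s t u :
  perm_eq (triangle x y z fx fy fz da db dc s t u)
          (triangle x y z fx fy fz ea eb ec s t u).
Proof.
by rewrite /triangle; do 3![apply: perm_cat; first exact: perm_strand; rewrite ?perm_cat2l].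
Qed.

(** If [x] and [y] are classical, so is [z], and the three weights agree. If they are virtual, [z]
    is the only corner that may be counted. *)
Lemma writhe_R3 L x y z da db dc cw s t u n :
  let T := triangle x y z (turn cw dc da) (turn cw da db) (turn cw db dc) in
  let w := T da db dc s t u in
  let w' := T (~~ da) (~~ db) (~~ dc) s t u in
  gauss_code w -> over_or_virtual L (x, ~~ turn cw dc da) (y, turn cw da db) ->
  (L x <> Virtual -> L z <> Virtual) ->
  writhe L w' n = writhe L w n.
Proof.
move=> T w w' gw ov Lxz; apply: eq_writhe; first exact: perm_triangle.
move=> v vw v_over; apply: gap_R3 => //; first exact: weight_odd.
  by case: ov => -[]; rewrite /weight /over /virtual_at /= => -> ->.
have [] := boolP (v.1 \in [:: x; y; z]); last by right; right.
rewrite !inE => v_near; case: ov => -[]; rewrite /over /virtual_at /= => Lx Ly.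
  by left; rewrite /weight /= Lx; move: Lxz; rewrite Lx; case: (L z) => // /(_ _) [].
by right; left; case/or3P: v_near => /eqP // vE; move: v_over; rewrite /is_over vE ?Lx ?Ly.
Qed.

Lemma writhe_move D D' :
  move D D' ->
  exists r : bool, forall n, n != 0 ->
    writhe (label D') (diag_curve D') n = writhe (label D) (diag_curve D) ((-1) ^+ r * n).
Proof.
have gauss (C : curve) : gauss_code C by have /andP[] := codeP C.
case=> {D D'} [D D' /writhe_same_diagram[r rP]|C C' L x b E|C C' L x y b db s t E E' ov
  |C C' L x y z da db dc cw s t u fx fy fz T E E' ov Lxz]; first by exists r.
all: exists false => n n0; rewrite expr0 mul1r /=; have := gauss C; have := gauss C'.
- by rewrite E => gC' gC; apply: writhe_R1.
- by rewrite E' E => gC' gC; apply: writhe_R2.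
- by rewrite E' E => gC' gC; apply: writhe_R3.
Qed.

(** Reversal may exchange the writhes at [n] and [-n]; the vanishing of all of them is insensitive
    to this. *)
Definition null_writhes (D : diagram) : Prop :=
  forall n, n != 0 -> writhe (label D) (diag_curve D) n = 0.

Lemma null_writhes_equivalent D D' :
  virtually_equivalent D D' -> (null_writhes D <-> null_writhes D').
Proof.
elim=> {D D'} [D D' /writhe_move[r rP]|//|D D' _ [h1 h2]
  |D1 D2 D3 _ [h1 h2] _ [h3 h4]]; last 1 first.
- by split=> [/h1/h3|/h4/h2].
- have sign_n0 n : n != 0 -> (-1) ^+ r * n != 0 :> int by move=> ?; rewrite mulf_neq0 ?signr_eq0.
  split=> D0 n n0; first by rewrite rP // D0 // sign_n0.
  by have := D0 _ (sign_n0 _ n0); rewrite rP ?sign_n0 // signrMK.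
- by split.
Qed.

Lemma classical_null_writhes D : classical_knot D -> null_writhes D.
Proof.
case=> D' [/null_writhes_equivalent[_ imp] nvD']; apply: imp => n.
exact: writhe_planar_classical.
Qed.

(** * Writhes of resolutions *)

Lemma mem_precrossings S v :
  (v.1 \in precrossings S) = ~~ is_virtual S v.1 && (v \in code (shadow_curve S)).
Proof.
have /andP[gw _] := codeP (shadow_curve S).
by rewrite mem_filter crossings_mem.
Qed.

(** The gap is the total weight strictly between the two passages through [c]. Virtual crossings
    weigh 0 and self-crossings of this arc cancel, which leaves the precrossings shared with the
    other component. *)
Lemma ind_gap S rho c :
  c \in precrossings S ->
  ind S c = gap (weight (label (resolve S rho))) (shadow_curve S) (c, true).
Proof.
set g := weight _; have g_odd : odd_weight g := weight_odd _.
have /andP[gw _] := codeP (shadow_curve S); have w_uniq := gauss_uniq gw.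
rewrite (mem_precrossings S (c, true)) => /andP[_ cw]; have cw' := gauss_twin gw cw.
rewrite /ind /smooth_component /=.
have gE v : v \in code (shadow_curve S) ->
    g v = if v.1 \in precrossings S then (-1) ^+ v.2 else 0.
  by rewrite mem_precrossings /g /weight /= => ->; case: (is_virtual S v.1).
have c_neq : (c, true) != (c, false) by rewrite xpair_eqE andbF.
(* [p1] and [p2] are the two components of the smoothing at [c]. *)
have [i p1 p2 <- <- rotE] := rot_to_arc w_uniq cw cw' c_neq.
rewrite -(gap_rot i g_odd gw cw) rotE /=.
have rot_mem v : (v \in (c, true) :: p1 ++ (c, false) :: p2) = (v \in code (shadow_curve S)).
  by rewrite -rotE mem_rot.
have: uniq ((c, true) :: p1 ++ (c, false) :: p2) by rewrite -rotE rot_uniq.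
rewrite /= cat_uniq mem_cat negb_or => /andP[/andP[cp1 _]] /and3P[p1_uniq /hasPn cp2 _].
have cp1' : (c, false) \notin p1 by apply: cp2; exact: mem_head.
have -> : gap g ((c, true) :: p1 ++ (c, false) :: p2) (c, true) = \sum_(v <- p1) g v.
  rewrite /gap /twin /= eqxx height_cat (negbTE cp1') /= eqxx height_notin // xpair_eqE andbF.
  ring.
have mem_p1 v : v \in p1 -> v \in code (shadow_curve S).
  by move=> vp1; rewrite -rot_mem inE mem_cat vp1 orbT.
have twin_p2 v : v \in p1 -> (twin v \in p2) = (twin v \notin p1).
  move=> vp1; have := gauss_twin gw (mem_p1 _ vp1).
  have twin_neq b : (twin v == (c, b)) = false.
    apply/negP => /eqP vE; move: vp1; rewrite -(twinK v) vE /twin /=; apply/negP.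
    by case: (b).
  rewrite -rot_mem !(inE, mem_cat) !twin_neq /=.
  have [tp1 _|_ //] := boolP (twin v \in p1).
  by apply: contraTF tp1 => tp2; apply: cp2; rewrite inE tp2 orbT.
rewrite [RHS](bigID (fun v => twin v \in p1)) /= [X in _ = X + _](_ : _ = 0) ?add0r; last first.
  rewrite -big_filter; apply: sum_odd_weight => //; first exact: filter_uniq.
  by move=> v; rewrite !mem_filter twinK andbC.
rewrite big_mkcond [RHS]big_mkcond; apply: eq_big_seq => v vp1 /=.
by rewrite gE ?mem_p1 // twin_p2 //; case: (_ \in precrossings S) => //=; case: ifP.
Qed.

Lemma precrossings_uniq S : uniq (precrossings S).
Proof.
have /andP[gw _] := codeP (shadow_curve S).
apply: filter_uniq; rewrite map_inj_in_uniq ?filter_uniq ?(gauss_uniq gw) //.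
by move=> [x b] [y c]; rewrite !mem_filter /= => /andP[-> _] /andP[-> _] ->.
Qed.

(** The over-passage of [c] is [(c, rho c)]; for a negative crossing it is the twin of [(c, true)],
    whence the opposite index. *)
Lemma writhe_resolve S rho n :
  writhe (label (resolve S rho)) (shadow_curve S) n =
    (count (fun c => rho c && (ind S c == n)) (precrossings S))%:Z
    - (count (fun c => ~~ rho c && (ind S c == - n)) (precrossings S))%:Z.
Proof.
have /andP[gw _] := codeP (shadow_curve S).
rewrite /writhe -big_filter_cond.
have over_perm : perm_eq [seq v <- code (shadow_curve S) | is_over (label (resolve S rho)) v]
    [seq (c, rho c) | c <- precrossings S].
  apply: uniq_perm; first exact: filter_uniq (gauss_uniq gw).
    by rewrite map_inj_uniq ?precrossings_uniq // => x y [].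
  move=> [x b]; rewrite mem_filter /is_over /=; apply/andP/mapP => [[]|[c cS [-> ->]]].
    case: ifP => // xS /eqP <- xw; exists x => //.
    by rewrite (mem_precrossings S (x, rho x)) xS.
  by move: cS; rewrite (mem_precrossings S (c, rho c)) => /andP[/negbTE-> ->].
rewrite (perm_big _ over_perm) big_map.
have gapE c : c \in precrossings S ->
    gap (weight (label (resolve S rho))) (shadow_curve S) (c, rho c)
    = if rho c then ind S c else - ind S c.
  move=> cS; rewrite (ind_gap rho cS); case: (rho c) => //.
  by rewrite -gap_twin //; exact: weight_odd.
elim: (precrossings S) gapE => [|c r IHr] gapE; first by rewrite big_nil.
rewrite big_cons IHr => [|a ar]; last by rewrite gapE // inE ar orbT.
rewrite gapE ?mem_head //= !PoszD; case: (rho c) => /=.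
  by case: eqP => _ /=; rewrite ?expr0; lia.
by rewrite eqr_oppLR; case: eqP => _ /=; rewrite ?expr1; lia.
Qed.

(** * Upper bounds for the virtualizing number *)

Lemma vir_le S k :
  nonclassical_with S k -> (vir S <= ((k : nat)%:R)%:E)%E.
Proof.
move=> nk; have [A [sigma [A_uniq A_sub A_size _]]] := nk.
have k_lt : (k < (size (precrossings S)).+1)%N by rewrite ltnS -A_size uniq_leq_size.
rewrite /vir; apply: (@bigmin_le_cond _ _ _ _ (Ordinal k_lt)); exact/asboolP.
Qed.

Lemma count_split (T : Type) (a P : pred T) (r : seq T) :
  count P r = (count (fun c => a c && P c) r + count (fun c => ~~ a c && P c) r)%N.
Proof.
rewrite -count_predUI [X in (_ + X)%N](@eq_count _ _ pred0) ?count_pred0 ?addn0.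
  by apply: eq_count => c /=; case: (a c); rewrite //= orbF.
by move=> c /=; case: (a c); case: (P c).
Qed.

Lemma nonclassical_unbalanced S m :
  (0 < m)%N ->
  count (fun c => ind S c == m%:Z) (precrossings S)
    <> count (fun c => ind S c == - m%:Z) (precrossings S) ->
  nonclassical_with S 0.
Proof.
move=> m0 neq; exists [::], (fun=> true); split=> // rho _ /classical_null_writhes nw.
apply: neq.
have := nw m%:Z; have := nw (- m%:Z).
rewrite /= !writhe_resolve opprK oppr_eq0 eqz_nat -lt0n m0 => /(_ isT) + /(_ isT).
(* Splitting both counts by the value of [rho] exhibits their difference as that of the two
   writhes. *)
rewrite (count_split rho (fun c => ind S c == m%:Z)) (count_split rho (fun c => ind S c == - m%:Z)).
lia.
Qed.

Lemma nonclassical_balanced S m k :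
  (0 < m)%N -> (0 < k)%N ->
  count (fun c => ind S c == m%:Z) (precrossings S) = k ->
  count (fun c => ind S c == - m%:Z) (precrossings S) = k ->
  nonclassical_with S k.+1.
Proof.
move=> m0 k0 pos_k neg_k.
have /hasP[c0 c0S /eqP c0_ind] : has (fun c => ind S c == - m%:Z) (precrossings S).
  by rewrite has_count neg_k.
exists (c0 :: [seq c <- precrossings S | ind S c == m%:Z]), (fun=> true).
have c0_neq : (ind S c0 == m%:Z) = false by rewrite c0_ind; apply/eqP; lia.
split.
- by rewrite /= mem_filter c0_neq filter_uniq // precrossings_uniq.
- by move=> c; rewrite inE mem_filter => /predU1P[->|/andP[]].
- by rewrite /= size_filter pos_k.
move=> rho rho1 /classical_null_writhes /(_ m%:Z).
rewrite /= eqz_nat -lt0n m0 writhe_resolve => /(_ isT).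
have -> : count (fun c => rho c && (ind S c == m%:Z)) (precrossings S) = k.
  rewrite -pos_k; apply: eq_in_count => c cS; have [cm|] := boolP (_ == _); rewrite ?andbF //.
  by rewrite rho1 // inE mem_filter cm cS orbT.
(* The negative part of the writhe omits [c0], so it cannot cancel the positive part [k]. *)
suff : (count (fun c => ~~ rho c && (ind S c == - m%:Z)) (precrossings S) < k)%N by lia.
rewrite -neg_k (count_split rho (fun c => ind S c == - m%:Z)) -[X in (X < _)%N]add0n ltn_add2r -has_count.
by apply/hasP; exists c0; rewrite // rho1 ?mem_head // c0_ind eqxx.
Qed.

Theorem proposition5p7 (S : virtual_shadow) :
  (exists2 c, c \in precrossings S & ind S c != 0) ->
  (vir S <= \big[mine/+oo]_(m <- [seq `|ind S c|%N | c <- precrossings S]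
                             | (0 < m)%N)
              ((size (precrossings_of_index S m))%:R / 2 + 1)%:E)%E.
Proof.
move=> _; rewrite big_seq_cond; apply: le_bigmin => [|m]; first exact: leey.
move=> /andP[/mapP[c cS mE] m0].
pose pos := count (fun c => ind S c == m%:Z) (precrossings S).
pose neg := count (fun c => ind S c == - m%:Z) (precrossings S).
have sizeE : size (precrossings_of_index S m) = (pos + neg)%N.
  rewrite size_filter /pos /neg -count_predUI [X in (_ + X)%N](@eq_count _ _ pred0).
    by rewrite count_pred0 addn0; apply: eq_count => a /=; lia.
  by move=> a /=; lia.
(* In the unbalanced case the bound 0 suffices; in the balanced one the set has [2 * pos] elements,
   and resolving [pos + 1] precrossings attains the stated bound exactly. *)
have [posE|/eqP pos_neq] := eqVneq pos neg; last first.
  apply: le_trans (vir_le (nonclassical_unbalanced m0 pos_neq)) _.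
  by rewrite lee_fin addr_ge0 // divr_ge0.
have pos0 : (0 < pos)%N.
  have : (0 < pos + neg)%N.
    by rewrite -sizeE -has_predT; apply/hasP; exists c; rewrite // mem_filter -mE eqxx.
  by rewrite posE addnn double_gt0.
apply: le_trans (vir_le (nonclassical_balanced m0 pos0 erefl (esym posE))) _.
rewrite lee_fin sizeE -posE addnn -muln2 natrM mulfK ?pnatr_eq0 // -addn1 natrD.
exact: lexx.
Qed.
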